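(* Let $\Gamma$ be a Coxeter graph of rank $n$, with Coxeter group $W_\Gamma$, Artin group $A_\Gamma$ and Coxeter element $c:=s_1\cdots s_n\in W_\Gamma$. Then $A_\Gamma$ is canonically isomorphic to the dual Artin group $A^*_\Gamma(c)$ if and only if the epimorphism $A_\Gamma\to W_\Gamma$, $t_i\mapsto s_i$, is injective on the set $\mathrm{Hur}(t_1,\dots,t_n)=\pi_A(Q)$.
   Context: A Coxeter graph $\Gamma$ of rank $n$ is a finite simplicial graph with vertices $1,\dots,n$ in which each edge $\{i,j\}$ carries a label $m_{ij}\in\{3,4,\dots\}\cup\{\infty\}$; if $i\ne j$ are not joined by an edge, put $m_{ij}=2$. For group elements $g,h$ and $k\in\mathbb N$, $\Pi(g,h;k)$ is the alternating product $ghg\cdots$ beginning with $g$ and with $k$ factors. The Artin group is $A_\Gamma=\langle t_1,\dots,t_n\mid \Pi(t_i,t_j;m_{ij})=\Pi(t_j,t_i;m_{ij})\text{ for all } i\neq j\text{ with } m_{ij}\neq\infty\rangle$. The Coxeter group $W_\Gamma$ is generated by $s_1,\dots,s_n$ with the corresponding relations together with $s_i^2=1$ for all $i$. Let $B_n$ be the braid group with standard generators $\sigma_1,\dots,\sigma_{n-1}$. For a group $G$, the Hurwitz action of $B_n$ on $G^n$ is given by $\sigma_i\cdot(g_1,\dots,g_n)=(g_1,\dots,g_{i-1},\,g_{i+1},\,g_{i+1}^{-1}g_ig_{i+1},\,g_{i+2},\dots,g_n)$. Let $\mathrm{Hur}(g_1,\dots,g_n)\subseteq G$ be the set of all elements appearing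 at any coordinate of some tuple in the orbit $B_n\cdot(g_1,\dots,g_n)$. The Hurwitz group $H(g_1,\dots,g_n)$ is the group with one generator $[r]$ for each $r\in \mathrm{Hur}(g_1,\dots,g_n)$ and relations $[r_2]^{-1}[r_1][r_2]=[r_2^{-1}r_1r_2]$ for all $(r_1,r_2,\dots,r_n)\in B_n\cdot(g_1,\dots,g_n)$. The dual Artin group for $c=s_1\cdots s_n$ is $A^*_\Gamma(c):=H(s_1,\dots,s_n)$. ''Canonically isomorphic'' means that the canonical epimorphism $A_\Gamma\to A^*_\Gamma(c)$, $t_i\mapsto[s_i]$, is an isomorphism. $F_n$ is the free group on $x_1,\dots,x_n$, $Q:=\mathrm{Hur}(x_1,\dots,x_n)\subseteq F_n$, and $\pi_A:F_n\to A_\Gamma$ is the homomorphism $x_i\mapsto t_i$. *)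

(* Defs.v *)
From HB Require Import structures.
From mathcomp Require Import all_boot.
From mathcomp Require Import boolp classical_sets functions.

Set Implicit Arguments.
Unset Strict Implicit.
Unset Printing Implicit Defensive.

Import Algebra.

Local Open Scope group_scope.
Local Open Scope quotient_scope.
Local Open Scope classical_set_scope.

Section FreeGroup.
Variable X : choiceType.

(* The letter (x, true) stands for x and (x, false) for x^-1. *)
Definition word := seq (X * bool).

Inductive free_eq : word -> word -> Prop :=
| free_refl u : free_eq u u
| free_sym u v : free_eq u v -> free_eq v u
| free_trans v u w : free_eq u v -> free_eq v w -> free_eq u w
| free_cancel u v x b :
    free_eq (u ++ (x, b) :: (x, ~~ b) :: v) (u ++ v).

Definition free_eqb (u v : word) : bool := `[< free_eq u v >].

Fact free_eqb_refl : reflexive free_eqb.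
Proof. by move=> u; apply/asboolP; apply: free_refl. Qed.

Fact free_eqb_sym : symmetric free_eqb.
Proof. by move=> u v; apply/asboolP/asboolP; apply: free_sym. Qed.

Fact free_eqb_trans : transitive free_eqb.
Proof.
move=> v u w /asboolP uv /asboolP vw; apply/asboolP.
exact: free_trans uv vw.
Qed.

Canonical free_equiv :=
  EquivRel free_eqb free_eqb_refl free_eqb_sym free_eqb_trans.

Definition free_group := {eq_quot free_eqb}.
HB.instance Definition _ := EqQuotient.on free_group.
HB.instance Definition _ := Choice.on free_group.

Lemma free_piP (u v : word) :
  (\pi_free_group u = \pi_free_group v) <-> free_eq u v.
Proof.
by split=> [/eqmodP/asboolP | uv]; [|apply/eqmodP/asboolP].
Qed.

Lemma free_reprK (g : free_group) : \pi_free_group (repr g) = g.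
Proof. exact: reprK. Qed.

Lemma free_catl w u v : free_eq u v -> free_eq (w ++ u) (w ++ v).
Proof.
elim=> {u v} [u|u v _|v u t _ IH1 _|u v x b].
- exact: free_refl.
- exact: free_sym.
- exact: free_trans.
- by rewrite !catA; apply: free_cancel.
Qed.

Lemma free_catr w u v : free_eq u v -> free_eq (u ++ w) (v ++ w).
Proof.
elim=> {u v} [u|u v _|v u t _ IH1 _|u v x b].
- exact: free_refl.
- exact: free_sym.
- exact: free_trans.
- by rewrite -!catA !cat_cons; apply: free_cancel.
Qed.

Definition word_inv (u : word) : word := rev [seq (l.1, ~~ l.2) | l <- u].

Lemma word_inv_cat u v : word_inv (u ++ v) = word_inv v ++ word_inv u.
Proof. by rewrite /word_inv map_cat rev_cat. Qed.

Lemma free_inv u v : free_eq u v -> free_eq (word_inv u) (word_inv v).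
Proof.
elim=> {u v} [u|u v _|v u t _ IH1 _|u v x b].
- exact: free_refl.
- exact: free_sym.
- exact: free_trans.
- rewrite !word_inv_cat /word_inv /= !rev_cons -!cats1 -!catA /= negbK.
  by have := free_cancel (word_inv v) (word_inv u) x b.
Qed.

Definition free_mul (g h : free_group) : free_group :=
  \pi_free_group (repr g ++ repr h).
Definition free_one : free_group := \pi_free_group [::].
Definition free_invg (g : free_group) : free_group :=
  \pi_free_group (word_inv (repr g)).

Lemma free_mul_pi u v :
  free_mul (\pi_free_group u) (\pi_free_group v) = \pi_free_group (u ++ v).
Proof.
apply/free_piP; apply: (@free_trans (u ++ repr (\pi_free_group v))).
- by apply/free_catr/free_piP; rewrite reprK.
- by apply/free_catl/free_piP; rewrite reprK.
Qed.

Lemma free_inv_pi u :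
  free_invg (\pi_free_group u) = \pi_free_group (word_inv u).
Proof. by apply/free_piP/free_inv/free_piP; rewrite reprK. Qed.

Fact free_mulA : associative free_mul.
Proof.
move=> g h k; rewrite -[g]free_reprK -[h]free_reprK -[k]free_reprK.
by rewrite 4!free_mul_pi catA.
Qed.

Fact free_mul1 : left_id free_one free_mul.
Proof. by move=> g; rewrite -[g]free_reprK free_mul_pi. Qed.

Fact free_mulr1 : right_id free_one free_mul.
Proof. by move=> g; rewrite -[g]free_reprK free_mul_pi cats0. Qed.

Lemma word_invK : involutive word_inv.
Proof.
move=> u; rewrite /word_inv map_rev revK -map_comp -[RHS]map_id.
by apply: eq_map => -[x b] /=; rewrite negbK.
Qed.

Lemma word_mulV u : free_eq (u ++ word_inv u) [::].
Proof.
elim: u => [|[x b] u IH]; first exact: free_refl.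
rewrite -cat1s word_inv_cat -!catA [_ ++ word_inv _ ++ _]catA.
apply: (@free_trans ([:: (x, b)] ++ word_inv [:: (x, b)])).
  by apply/free_catl; rewrite -[X in free_eq _ X]cat0s; apply/free_catr.
exact: (free_cancel [::] [::]).
Qed.

Fact free_mulgV : right_inverse free_one free_invg free_mul.
Proof.
by move=> g; rewrite -[g]free_reprK free_inv_pi free_mul_pi; apply/free_piP/word_mulV.
Qed.

Fact free_mulVg : left_inverse free_one free_invg free_mul.
Proof.
move=> g; rewrite -[g]free_reprK free_inv_pi free_mul_pi; apply/free_piP.
by rewrite -{2}[repr g]word_invK; apply: word_mulV.
Qed.

HB.instance Definition _ := isGroup.Build free_group
  free_mulA free_mul1 free_mulr1 free_mulVg free_mulgV.

Definition free_gen (x : X) : free_group := \pi_free_group [:: (x, true)].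

Section Lift.
Variables (G : groupType) (f : X -> G).

Definition word_eval (u : word) : G :=
  foldr (fun l g => (if l.2 then f l.1 else (f l.1)^-1) * g) 1 u.

Lemma word_eval_cat u v : word_eval (u ++ v) = word_eval u * word_eval v.
Proof.
by elim: u => [|l u IH] /=; rewrite ?mul1g // IH mulgA.
Qed.

Lemma word_eval_free u v : free_eq u v -> word_eval u = word_eval v.
Proof.
elim=> {u v} [//|//|v u w _ -> _ -> //|u v x b].
rewrite !word_eval_cat /=; congr (_ * _).
by case: b; rewrite /= mulgA ?mulgV ?mulVg mul1g.
Qed.

Definition free_lift (g : free_group) : G := word_eval (repr g).

Lemma free_lift_pi u : free_lift (\pi_free_group u) = word_eval u.
Proof. by apply/word_eval_free/free_piP; rewrite reprK. Qed.

Fact free_lift_mul : {morph free_lift : g h / g * h}.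
Proof.
move=> g h; rewrite -[g]free_reprK -[h]free_reprK [_ * _]free_mul_pi !free_lift_pi.
exact: word_eval_cat.
Qed.

HB.instance Definition _ :=
  isMultiplicative.Build free_group G free_lift free_lift_mul.

Lemma free_lift_gen x : free_lift (free_gen x) = f x.
Proof. by rewrite free_lift_pi /= mulg1. Qed.

End Lift.
End FreeGroup.

Section Presentation.
Variables (X : choiceType) (R : free_group X -> free_group X -> Prop).

(* Compatibility with inverses is automatic (pres_invc). *)
Inductive pres_eq : free_group X -> free_group X -> Prop :=
| pres_rel u v : R u v -> pres_eq u v
| pres_refl u : pres_eq u u
| pres_sym u v : pres_eq u v -> pres_eq v u
| pres_trans v u w : pres_eq u v -> pres_eq v w -> pres_eq u w
| pres_mulc u u' v v' :
    pres_eq u u' -> pres_eq v v' -> pres_eq (u * v) (u' * v').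

Definition pres_eqb (u v : free_group X) : bool := `[< pres_eq u v >].

Fact pres_eqb_refl : reflexive pres_eqb.
Proof. by move=> u; apply/asboolP; apply: pres_refl. Qed.

Fact pres_eqb_sym : symmetric pres_eqb.
Proof. by move=> u v; apply/asboolP/asboolP; apply: pres_sym. Qed.

Fact pres_eqb_trans : transitive pres_eqb.
Proof.
move=> v u w /asboolP uv /asboolP vw; apply/asboolP.
exact: pres_trans uv vw.
Qed.

Canonical pres_equiv :=
  EquivRel pres_eqb pres_eqb_refl pres_eqb_sym pres_eqb_trans.

Definition presented := {eq_quot pres_eqb}.
HB.instance Definition _ := EqQuotient.on presented.
HB.instance Definition _ := Choice.on presented.

Lemma pres_piP u v : (\pi_presented u = \pi_presented v) <-> pres_eq u v.
Proof.
by split=> [/eqmodP/asboolP | uv]; [|apply/eqmodP/asboolP].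
Qed.

Lemma pres_reprK (g : presented) : \pi_presented (repr g) = g.
Proof. exact: reprK. Qed.

Lemma pres_invc u v : pres_eq u v -> pres_eq u^-1 v^-1.
Proof.
move=> uv; rewrite -[u^-1]mulg1 -(mulgV v) -[v^-1 in X in pres_eq _ X]mul1g.
rewrite -(mulVg u) mulgA; apply: pres_mulc; last exact: pres_refl.
by apply: pres_mulc; [exact: pres_refl | exact: pres_sym].
Qed.

Definition pres_mul (g h : presented) : presented :=
  \pi_presented (repr g * repr h).
Definition pres_one : presented := \pi_presented 1.
Definition pres_invg (g : presented) : presented :=
  \pi_presented ((repr g)^-1).

Lemma pres_mul_pi u v :
  pres_mul (\pi_presented u) (\pi_presented v) = \pi_presented (u * v).
Proof. by apply/pres_piP/pres_mulc; apply/pres_piP; rewrite reprK. Qed.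

Lemma pres_inv_pi u : pres_invg (\pi_presented u) = \pi_presented u^-1.
Proof. by apply/pres_piP/pres_invc/pres_piP; rewrite reprK. Qed.

Fact pres_mulA : associative pres_mul.
Proof.
move=> g h k; rewrite -[g]pres_reprK -[h]pres_reprK -[k]pres_reprK.
by rewrite 4!pres_mul_pi mulgA.
Qed.

Fact pres_mul1 : left_id pres_one pres_mul.
Proof. by move=> g; rewrite -[g]pres_reprK pres_mul_pi mul1g. Qed.

Fact pres_mulr1 : right_id pres_one pres_mul.
Proof. by move=> g; rewrite -[g]pres_reprK pres_mul_pi mulg1. Qed.

Fact pres_mulVg : left_inverse pres_one pres_invg pres_mul.
Proof. by move=> g; rewrite -[g]pres_reprK pres_inv_pi pres_mul_pi mulVg. Qed.

Fact pres_mulgV : right_inverse pres_one pres_invg pres_mul.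
Proof. by move=> g; rewrite -[g]pres_reprK pres_inv_pi pres_mul_pi mulgV. Qed.

HB.instance Definition _ := isGroup.Build presented
  pres_mulA pres_mul1 pres_mulr1 pres_mulVg pres_mulgV.

Definition pres_gen (x : X) : presented := \pi_presented (free_gen x).

Lemma pres_gen_lift (u : free_group X) :
  free_lift pres_gen u = \pi_presented u.
Proof.
rewrite -[u]free_reprK free_lift_pi.
elim: (repr u) => [//|[x b] w /= ->].
have E : (if b then pres_gen x else (pres_gen x)^-1) =
         \pi_presented (\pi_(free_group X) [:: (x, b)]).
  case: b => //; rewrite [LHS]pres_inv_pi; congr (\pi_presented _).
  exact: free_inv_pi.
rewrite E [LHS]pres_mul_pi; congr (\pi_presented _).
exact: (free_mul_pi [:: (x, b)] w).
Qed.

Lemma pres_gen_rel u v : R u v -> free_lift pres_gen u = free_lift pres_gen v.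
Proof. by move=> uv; rewrite !pres_gen_lift; apply/pres_piP/pres_rel. Qed.

Section Lift.
Variables (G : groupType) (f : X -> G).
Hypothesis fR : forall u v, R u v -> free_lift f u = free_lift f v.

Lemma free_lift_pres u v : pres_eq u v -> free_lift f u = free_lift f v.
Proof.
elim=> {u v} [u v /fR //|//|//|v u w _ -> _ -> //|u u' v v' _ E1 _ E2].
by rewrite !free_lift_mul E1 E2.
Qed.

Definition pres_lift (_ : forall u v, R u v -> free_lift f u = free_lift f v)
  (g : presented) : G := free_lift f (repr g).

Lemma pres_lift_pi u : pres_lift fR (\pi_presented u) = free_lift f u.
Proof. by apply/free_lift_pres/pres_piP; rewrite reprK. Qed.

Fact pres_lift_mul : {morph pres_lift fR : g h / g * h}.
Proof.
move=> g h; rewrite -[g]pres_reprK -[h]pres_reprK [_ * _]pres_mul_pi !pres_lift_pi.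
exact: gmulfM.
Qed.

HB.instance Definition _ :=
  isMultiplicative.Build presented G (pres_lift fR) pres_lift_mul.

Lemma pres_lift_gen x : pres_lift fR (pres_gen x) = f x.
Proof. by rewrite pres_lift_pi free_lift_gen. Qed.

End Lift.
End Presentation.

Arguments pres_gen {X} R x.
Arguments pres_lift {X R G f} fR g.

Section Sym.
Variable T : Type.

Record sym := Sym {
  sym_fun :> T -> T;
  sym_inv : T -> T;
  symK : cancel sym_fun sym_inv;
  symVK : cancel sym_inv sym_fun
}.

HB.instance Definition _ := gen_eqMixin sym.
HB.instance Definition _ := gen_choiceMixin sym.

Lemma symP (s t : sym) : (forall x, s x = t x) -> s = t.
Proof.
case: s t => [f f' fK f'K] [g g' gK g'K] /= /funext efg.
rewrite -{}efg in gK g'K *.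
have ef' : f' = g' by apply/funext => x; rewrite -{1}(g'K x) fK.
rewrite -{}ef' in gK g'K *.
by rewrite (Prop_irrelevance gK fK) (Prop_irrelevance g'K f'K).
Qed.

Definition sym_one : sym := @Sym id id (fun=> erefl) (fun=> erefl).
Definition sym_invg (s : sym) : sym := Sym (symVK s) (symK s).
Definition sym_mul (s t : sym) : sym :=
  Sym (can_comp (symK s) (symK t)) (can_comp (symVK t) (symVK s)).

Fact sym_mulA : associative sym_mul. Proof. by move=> s t u; apply: symP. Qed.
Fact sym_mul1 : left_id sym_one sym_mul. Proof. by move=> s; apply: symP. Qed.
Fact sym_mulr1 : right_id sym_one sym_mul. Proof. by move=> s; apply: symP. Qed.
Fact sym_mulVg : left_inverse sym_one sym_invg sym_mul.
Proof. by move=> s; apply: symP => x /=; rewrite symK. Qed.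
Fact sym_mulgV : right_inverse sym_one sym_invg sym_mul.
Proof. by move=> s; apply: symP => x /=; rewrite symVK. Qed.

HB.instance Definition _ := isGroup.Build sym
  sym_mulA sym_mul1 sym_mulr1 sym_mulVg sym_mulgV.

End Sym.

(* The indices are shifted by one: the generators are sigma_0, ..., sigma_(n-2),
   and the coordinates of an n-tuple are numbered from 0 to n - 1. *)

Inductive braid_rel (n : nat) :
  free_group 'I_n.-1 -> free_group 'I_n.-1 -> Prop :=
| braid_adjacent (i j : 'I_n.-1) : j = i.+1 :> nat ->
    braid_rel (free_gen i * free_gen j * free_gen i)
              (free_gen j * free_gen i * free_gen j)
| braid_distant (i j : 'I_n.-1) : (i.+1 < j)%N ->
    braid_rel (free_gen i * free_gen j) (free_gen j * free_gen i).

Definition braid_group (n : nat) := presented (@braid_rel n).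
HB.instance Definition _ n := Group.on (braid_group n).

Definition braid_gen (n : nat) (i : 'I_n.-1) : braid_group n :=
  pres_gen (@braid_rel n) i.

Section Hurwitz.
Variables (n : nat) (G : groupType).
Implicit Types (g : 'I_n -> G) (p q r s : 'I_n) (i j : 'I_n.-1).

Definition lo_ord i : 'I_n := widen_ord (leq_pred n) i.

Fact hi_ord_subproof i : (i.+1 < n)%N.
Proof. by rewrite -ltn_predRL. Qed.
Definition hi_ord i : 'I_n := Ordinal (hi_ord_subproof i).

Definition hmove p q g : 'I_n -> G :=
  fun k => if k == p then g q else if k == q then (g q)^-1 * g p * g q
           else g k.
Definition hmove_inv p q g : 'I_n -> G :=
  fun k => if k == p then g p * g q * (g p)^-1 else if k == q then g p
           else g k.

Lemma lo_hi i : (hi_ord i == lo_ord i) = false.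
Proof. by apply/eqP => /(congr1 val) /= /eqP; rewrite eqn_leq ltnn. Qed.

Lemma hmoveK p q : (q == p) = false -> cancel (hmove p q) (hmove_inv p q).
Proof.
move=> qp g; apply/funext => k; rewrite /hmove /hmove_inv qp !eqxx.
case: (eqVneq k p) => [->|_]; first by rewrite !mulgA mulgV mul1g mulgK.
by case: (eqVneq k q) => [->|].
Qed.

Lemma hmove_invK p q : (q == p) = false -> cancel (hmove_inv p q) (hmove p q).
Proof.
move=> qp g; apply/funext => k; rewrite /hmove /hmove_inv qp !eqxx.
case: (eqVneq k p) => [->//|_]; case: (eqVneq k q) => [->|//].
by rewrite !mulgA mulVg mul1g mulgVK.
Qed.

Definition hurwitz_sigma i : sym ('I_n -> G) :=
  Sym (hmoveK (lo_hi i)) (hmove_invK (lo_hi i)).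

Lemma hmove_braid p q r g : uniq [:: p; q; r] ->
  hmove p q (hmove q r (hmove p q g)) = hmove q r (hmove p q (hmove q r g)).
Proof.
rewrite /= !inE negb_or andbT => /andP[/andP[pq pr] qr].
have E := (negPf pq, negPf pr, negPf qr, eq_sym q p, eq_sym r p, eq_sym r q).
apply/funext => k; rewrite /hmove !E !eqxx /=.
case: (eqVneq k p) => [->|kp]; first by rewrite !E.
case: (eqVneq k q) => [//|kq].
by case: (eqVneq k r) => [_|//]; rewrite !invgM !invgK !mulgA ?mulgK ?mulgVK.
Qed.

Lemma hmove_far p q r s g : uniq [:: p; q; r; s] ->
  hmove p q (hmove r s g) = hmove r s (hmove p q g).
Proof.
rewrite /= !inE !negb_or !andbT => /and3P[/and3P[pq pr ps] /andP[qr qs] rs].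
have E := (negPf pq, negPf pr, negPf ps, negPf qr, negPf qs, negPf rs).
have E' := (eq_sym r p, eq_sym s p, eq_sym r q, eq_sym s q, E).
apply/funext => k; rewrite /hmove !E' /=.
case: (eqVneq k p) => [->|kp]; first by rewrite !E.
by case: (eqVneq k q) => [->|kq] //; rewrite !E.
Qed.

Fact hurwitz_braid u v : @braid_rel n u v ->
  free_lift hurwitz_sigma u = free_lift hurwitz_sigma v.
Proof.
case=> i j ij; rewrite !free_lift_mul !free_lift_gen; apply: symP => g /=.
- have -> : lo_ord j = hi_ord i by apply: val_inj.
  apply: hmove_braid; rewrite /= !inE andbT -!val_eqE /= ij.
  by rewrite !(ltn_eqF (ltnSn _)) (ltn_eqF (ltnW (ltnSn _))).
- apply: hmove_far; rewrite /= !inE -!val_eqE /=.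
  have lt_ij := ltnW ij; have lt_ijS := ltnW (lt_ij : i.+1 < j.+1)%N.
  by rewrite eqSS !(ltn_eqF (ltnSn _), ltn_eqF ij, ltn_eqF lt_ij,
                    ltn_eqF lt_ijS).
Qed.

(* The Hurwitz action, as a homomorphism to the group of permutations of G^n
   (with composition of functions as product, so this is a left action). *)
Definition hurwitz_act : braid_group n -> sym ('I_n -> G) :=
  pres_lift hurwitz_braid.

HB.instance Definition _ := Multiplicative.on hurwitz_act.

Lemma hurwitz_act_gen i g :
  hurwitz_act (braid_gen i) g =
    fun k => if k == i :> nat then g (hi_ord i)
      else if k == i.+1 :> nat
           then (g (hi_ord i))^-1 * g (lo_ord i) * g (hi_ord i)
      else g k.
Proof. by rewrite /hurwitz_act pres_lift_gen. Qed.

Definition hurwitz_orbit g : set ('I_n -> G) :=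
  [set h | exists b : braid_group n, h = hurwitz_act b g].

Definition Hur g : set G :=
  [set r | exists2 h, hurwitz_orbit g h & exists k, r = h k].

Lemma Hur_mem g k : g k \in Hur g.
Proof.
apply/mem_set; exists g; last by exists k.
exists 1; have/(@mulgI _ (hurwitz_act 1)) :
  hurwitz_act 1 * hurwitz_act 1 = hurwitz_act 1 * 1.
  by rewrite -gmulfM !mulg1.
by move=> ->.
Qed.

Definition Hur_coord g k : Hur g := exist _ (g k) (Hur_mem g k).

(* For n < 2 there is no pair of leading coordinates, hence no relation. *)
Inductive hurwitz_rel g : free_group (Hur g) -> free_group (Hur g) -> Prop :=
| Hurwitz_rel h (i0 i1 : 'I_n) (r1 r2 r3 : Hur g) :
    hurwitz_orbit g h -> i0 = 0%N :> nat -> i1 = 1%N :> nat ->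
    val r1 = h i0 -> val r2 = h i1 ->
    val r3 = (val r2)^-1 * val r1 * val r2 ->
    hurwitz_rel ((free_gen r2)^-1 * free_gen r1 * free_gen r2) (free_gen r3).

Definition hurwitz_group g := presented (@hurwitz_rel g).
HB.instance Definition _ g := Group.on (hurwitz_group g).

Definition hurwitz_gen g (r : Hur g) : hurwitz_group g :=
  pres_gen (@hurwitz_rel g) r.

End Hurwitz.

(* Labels of edges; None stands for infinity.  The values of label at pairs
   that are not edges are irrelevant. *)
Record coxeter_graph (n : nat) := CoxeterGraph {
  edge : rel 'I_n;
  edge_sym : symmetric edge;
  edge_irr : irreflexive edge;
  label : 'I_n -> 'I_n -> option nat;
  label_sym : forall i j, edge i j -> label i j = label j i;
  label_ge3 : forall i j k, edge i j -> label i j = Some k -> (3 <= k)%N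
}.

Definition coxeter_m n (Gamma : coxeter_graph n) (i j : 'I_n) : option nat :=
  if edge Gamma i j then label Gamma i j else Some 2.

Fixpoint altprod (G : groupType) (g h : G) (k : nat) : G :=
  if k is k'.+1 then g * altprod h g k' else 1.

Section Artin.
Variables (n : nat) (Gamma : coxeter_graph n).

Inductive artin_rel : free_group 'I_n -> free_group 'I_n -> Prop :=
| Artin_rel (i j : 'I_n) (k : nat) : i != j -> coxeter_m Gamma i j = Some k ->
    artin_rel (altprod (free_gen i) (free_gen j) k)
              (altprod (free_gen j) (free_gen i) k).

Inductive coxeter_rel : free_group 'I_n -> free_group 'I_n -> Prop :=
| Coxeter_braid u v : artin_rel u v -> coxeter_rel u v
| Coxeter_square (i : 'I_n) : coxeter_rel (free_gen i ^+ 2) 1.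

Definition artin_group := presented artin_rel.
HB.instance Definition _ := Group.on artin_group.

Definition coxeter_group := presented coxeter_rel.
HB.instance Definition _ := Group.on coxeter_group.

Definition artin_gen : 'I_n -> artin_group := pres_gen artin_rel.
Definition coxeter_gen : 'I_n -> coxeter_group := pres_gen coxeter_rel.

Definition pi_A : free_group 'I_n -> artin_group := free_lift artin_gen.
HB.instance Definition _ := Multiplicative.on pi_A.

Fact artin_to_coxeter_subproof u v : artin_rel u v ->
  free_lift coxeter_gen u = free_lift coxeter_gen v.
Proof. by move=> uv; apply/pres_gen_rel/Coxeter_braid. Qed.

Definition artin_to_coxeter : artin_group -> coxeter_group :=
  pres_lift artin_to_coxeter_subproof.
HB.instance Definition _ := Multiplicative.on artin_to_coxeter.

Lemma artin_to_coxeter_gen i : artin_to_coxeter (artin_gen i) = coxeter_gen i.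
Proof. exact: pres_lift_gen. Qed.

(* The dual Artin group with respect to the Coxeter element
   s_0 * ... * s_(n-1), which enters only through this factorization. *)
Definition dual_artin_group := hurwitz_group coxeter_gen.
HB.instance Definition _ := Group.on dual_artin_group.

Definition dual_gen (i : 'I_n) : dual_artin_group :=
  hurwitz_gen (Hur_coord coxeter_gen i).

(* The homomorphism t_i |-> [s_i] is unique, as the t_i generate. *)
Definition canonically_isomorphic_to_dual : Prop :=
  exists f : {multiplicative artin_group -> dual_artin_group},
    (forall i, f (artin_gen i) = dual_gen i) /\ bijective f.

End Artin.

Arguments artin_to_coxeter {n} Gamma g.
Arguments pi_A {n} Gamma g.

(* Main.v *)
Require Import Defs.
From mathcomp Require Import all_boot.
From mathcomp Require Import boolp classical_sets functions.

(* The Hurwitz action commutes with homomorphisms, and two coordinates braided to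
   the left past a third one do not change, so the defining relations of the dual
   group hold for every adjacent pair of every tuple in the orbit. Hence
   beta.([s_1], ..., [s_n]) is obtained by bracketing the coordinates of
   beta.(s_1, ..., s_n). Braiding an adjacent pair (a, b) repeatedly yields the
   sequence a, b, b^-1 a b, ..., whose m-th term (counted from 0) equals a exactly
   when a and b satisfy the braid relation of length m; so the Artin relations pass
   from W to the dual group and t_i |-> [s_i] is always a homomorphism. It maps
   beta.t to beta.[s], so elements of Hur(t) lying over the same r in W have the same
   image [r]: if it is injective, so is A -> W on Hur(t). Conversely, if A -> W is
   injective on Hur(t), lifting each r to Hur(t) defines the inverse. *)

Import Algebra.

Local Open Scope group_scope.
Local Open Scope classical_set_scope.

(** * Homomorphisms, and their uniqueness on presented groups *)

Section Multiplicative.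
Context {G H : groupType} (f : {multiplicative G -> H}).

Lemma multiplicative1 : f 1 = 1.
Proof. by apply: (@mulgI _ (f 1)); rewrite -gmulfM !mulg1. Qed.

Lemma multiplicativeV : {morph f : x / x^-1}.
Proof. by move=> x; apply: (@mulgI _ (f x)); rewrite -gmulfM !mulgV multiplicative1. Qed.

End Multiplicative.

Section Presented.
Context {X : choiceType} {R : free_group X -> free_group X -> Prop}.

Lemma presented_ext {G : groupType} (f g : {multiplicative presented R -> G}) :
  (forall x, f (pres_gen R x) = g (pres_gen R x)) -> f =1 g.
Proof.
move=> fg x; rewrite -[x]pres_reprK -pres_gen_lift -[repr x]free_reprK free_lift_pi.
elim: (repr _) => [|[y b] w IH] /=; first by rewrite !multiplicative1.
by rewrite !gmulfM IH; case: b; rewrite ?multiplicativeV fg.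
Qed.

End Presented.

(** * Naturality of the Hurwitz action; making two coordinates adjacent *)

Section Equivariance.
Context {n : nat}.

(** A relation is used instead of a map because bracketing makes sense only on elements of
    [Hur g]. *)
Lemma hurwitz_act_ind {G G' : groupType}
    (R : ('I_n -> G) -> ('I_n -> G') -> Prop) :
  (forall i g g', R g g' -> R (hurwitz_sigma G i g) (hurwitz_sigma G' i g')) ->
  (forall i g g', R g g' ->
    R (sym_inv (hurwitz_sigma G i) g) (sym_inv (hurwitz_sigma G' i) g')) ->
  forall b g g', R g g' -> R (hurwitz_act G b g) (hurwitz_act G' b g').
Proof.
move=> Rs RV b g g' Rgg'.
rewrite -[b]pres_reprK /hurwitz_act !pres_lift_pi -[repr b]free_reprK !free_lift_pi.
elim: (repr _) => [//|[i []] w IH] /=; [exact: Rs | exact: RV].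
Qed.

Lemma hurwitz_act_morph {G G' : groupType} (f : {multiplicative G -> G'}) b
    (g : 'I_n -> G) :
  hurwitz_act G' b (f \o g) = f \o hurwitz_act G b g.
Proof.
apply: (hurwitz_act_ind (fun g g' => g' = f \o g)) => // i {}g _ ->;
  apply/funext => k /=; rewrite /hmove /hmove_inv /=;
  by do 2?case: ifP => _ //; rewrite !gmulfM multiplicativeV.
Qed.

Lemma hurwitz_act1 {G : groupType} (g : 'I_n -> G) : hurwitz_act G 1 g = g.
Proof. by rewrite multiplicative1. Qed.

Lemma hurwitz_actM {G : groupType} b b' (g : 'I_n -> G) :
  hurwitz_act G (b * b') g = hurwitz_act G b (hurwitz_act G b' g).
Proof. by rewrite gmulfM. Qed.

Lemma Hur_morph {G G' : groupType} (f : {multiplicative G -> G'})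
    (g : 'I_n -> G) : Hur (f \o g) = f @` Hur g.
Proof.
apply/seteqP; split=> [_ [_ [b ->] [k ->]]|_ [_ [_ [b ->] [k ->]] <-]].
  exists (hurwitz_act G b g k); last by rewrite hurwitz_act_morph.
  by exists (hurwitz_act G b g); [exists b | exists k].
exists (hurwitz_act G' b (f \o g)); first by exists b.
by exists k; rewrite hurwitz_act_morph.
Qed.

Lemma hurwitz_orbit_act {G : groupType} b (g h : 'I_n -> G) :
  hurwitz_orbit g h -> hurwitz_orbit g (hurwitz_act G b h).
Proof. by case=> b' ->; exists (b * b'); rewrite hurwitz_actM. Qed.

Lemma hurwitz_act_sigma {G : groupType} (i : 'I_n.-1) :
  hurwitz_act G (braid_gen i) = hurwitz_sigma G i.
Proof. exact: pres_lift_gen. Qed.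

Lemma hurwitz_act_lo {G : groupType} (i : 'I_n.-1) (g : 'I_n -> G) :
  hurwitz_act G (braid_gen i) g (lo_ord i) = g (hi_ord i).
Proof. by rewrite hurwitz_act_gen eqxx. Qed.

Lemma hurwitz_act_hi {G : groupType} (i : 'I_n.-1) (g : 'I_n -> G) :
  hurwitz_act G (braid_gen i) g (hi_ord i) =
  (g (hi_ord i))^-1 * g (lo_ord i) * g (hi_ord i).
Proof. by rewrite hurwitz_act_gen gtn_eqF ?eqxx. Qed.

Lemma hurwitz_act_out {G : groupType} (i : 'I_n.-1) (g : 'I_n -> G) (k : 'I_n) :
  k != i :> nat -> k != i.+1 :> nat ->
  hurwitz_act G (braid_gen i) g k = g k.
Proof. by move=> /negPf ki /negPf kSi; rewrite hurwitz_act_gen ki kSi. Qed.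

(** The coordinate at [q] is braided to the left, unchanged, past everything strictly between [p]
    and [q]. *)
Lemma braid_adjoin (p q : 'I_n) : (p < q)%N ->
  exists (b : braid_group n) (i : 'I_n.-1), forall (G : groupType) (g : 'I_n -> G),
    hurwitz_act G b g (lo_ord i) = g p /\ hurwitz_act G b g (hi_ord i) = g q.
Proof.
elim: {q}(q : nat) {-2}q (erefl (q : nat)) => [|d IH] q qE; rewrite qE // ltnS => pd.
have dn : (d < n.-1)%N by rewrite ltn_predRL -qE.
have -> : q = hi_ord (Ordinal dn) by apply: val_inj.
move: pd; rewrite leq_eqVlt => /predU1P[pE|pd].
  exists 1, (Ordinal dn) => G g; rewrite hurwitz_act1; split => //.
  by congr g; apply: val_inj.
have [b [i bi]] := IH (lo_ord (Ordinal dn)) erefl pd.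
exists (b * braid_gen (Ordinal dn)), i => G g; rewrite hurwitz_actM.
have [-> ->] := bi G (hurwitz_act G (braid_gen (Ordinal dn)) g).
by rewrite hurwitz_act_lo hurwitz_act_out //= neq_ltn ?pd // ltnW.
Qed.

End Equivariance.

(** * Relations of the Hurwitz group and bracketing of orbits *)

Section HurwitzGroup.
Context {n : nat} {G : groupType} (g : 'I_n -> G).

Lemma hurwitz_gen_conj (h : 'I_n -> G) (i : 'I_n.-1) (r1 r2 r3 : Hur g) :
  hurwitz_orbit g h -> val r1 = h (lo_ord i) -> val r2 = h (hi_ord i) ->
  val r3 = (val r2)^-1 * val r1 * val r2 ->
  (hurwitz_gen r2)^-1 * hurwitz_gen r1 * hurwitz_gen r2 = hurwitz_gen r3.
Proof.
(* Braiding two coordinates to the left past a third one leaves them unchanged,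
   so an adjacent pair can be brought to the two leading positions. *)
elim: {i}(i : nat) {-2}i (erefl (i : nat)) h => [|m IH] i iE h gh r1E r2E r3E.
  have gh2 : hurwitz_rel ((free_gen r2)^-1 * free_gen r1 * free_gen r2) (free_gen r3).
    by apply: (@Hurwitz_rel _ _ _ h (lo_ord i) (hi_ord i)); rewrite //= iE.
  have := pres_gen_rel gh2.
  by rewrite !gmulfM multiplicativeV /= !free_lift_gen.
have mn : (m < n.-1)%N by rewrite (leq_trans _ (ltn_ord i)) // iE.
pose j := Ordinal mn.
have ji : lo_ord i = hi_ord j by apply: val_inj.
apply: (IH j erefl (hurwitz_act G (braid_gen i) (hurwitz_act G (braid_gen j) h))) => //.
- by do 2!apply: hurwitz_orbit_act.
- by rewrite r1E hurwitz_act_out ?hurwitz_act_lo ?ji //= iE neq_ltn ltnS ?leqnSn ?leqnn.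
- by rewrite -ji hurwitz_act_lo r2E hurwitz_act_out //= iE neq_ltn ltnS ?leqnSn ?leqnn orbT.
Qed.

Lemma Hur_orbit {h : 'I_n -> G} k :
  hurwitz_orbit g h -> exists r : Hur g, val r = h k.
Proof.
move=> gh; have hk : h k \in Hur g by apply/mem_set; exists h; last exists k.
by exists (exist (fun x => x \in Hur g) _ hk).
Qed.

Lemma Hur_val (r : Hur g) : exists b k, val r = hurwitz_act G b g k.
Proof. by have /set_mem[_ [b ->] [k rE]] := valP r; exists b, k. Qed.

Lemma hurwitz_act_hurwitz_gen b k (r : Hur g) :
  val r = hurwitz_act G b g k ->
  hurwitz_act (hurwitz_group g) b (fun i => hurwitz_gen (Hur_coord g i)) k =
  hurwitz_gen r.
Proof.
(* Orbit membership is carried along because [hurwitz_gen_conj] requires it at each move. *)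
pose R (h : 'I_n -> G) (x : 'I_n -> hurwitz_group g) :=
  hurwitz_orbit g h /\ forall k (r : Hur g), val r = h k -> x k = hurwitz_gen r.
suff [_ Rb] : R (hurwitz_act G b g)
    (hurwitz_act (hurwitz_group g) b (fun i => hurwitz_gen (Hur_coord g i))).
  exact: Rb.
apply: hurwitz_act_ind => [i h x [gh hx]|i h x [gh hx]|]; last first.
- split=> [|k' r' r'E]; first by exists 1; rewrite hurwitz_act1.
  by congr hurwitz_gen; apply: val_inj; rewrite r'E.
- set h' := sym_inv _ h.
  have gh' : hurwitz_orbit g h'.
    case: gh => b' hE; exists ((braid_gen i)^-1 * b').
    by rewrite hurwitz_actM -hE multiplicativeV /= hurwitz_act_sigma.
  have h'E : h = hurwitz_sigma G i h' by rewrite symVK.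
  split=> // k' r' r'E.
  rewrite /= /hmove_inv.
  have [kE|klo] := eqVneq k' (lo_ord i).
    have [r1 r1E] := Hur_orbit (hi_ord i) gh'.
    have [r2 r2E] := Hur_orbit (hi_ord i) gh.
    have xlo : x (lo_ord i) = hurwitz_gen r1.
      by apply: hx; rewrite h'E /= /hmove eqxx.
    rewrite xlo (hx _ _ r2E).
    (* For an inverse move the relation is taken at the new tuple [h']: it gives [r2] as the
       conjugate of [r'] by [r1], and is solved for [r']. *)
    rewrite -(hurwitz_gen_conj h' i r' r1 r2) //.
    + by rewrite !mulgA mulgV mul1g mulgK.
    + by rewrite r'E kE.
    + by rewrite r2E r'E r1E h'E /= /hmove lo_hi eqxx kE.
  have [kE|khi] := eqVneq k' (hi_ord i).
    by apply: hx; rewrite h'E /= /hmove eqxx r'E kE.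
  by apply: hx; rewrite h'E /= /hmove (negPf klo) (negPf khi).
- split=> [|k' r' /=]; rewrite /hmove.
    by rewrite -hurwitz_act_sigma; apply: hurwitz_orbit_act.
  have [_ r'E|_] := eqVneq k' (lo_ord i); first exact: hx.
  have [_ r'E|_ r'E] := eqVneq k' (hi_ord i); last exact: hx.
  have [r1 r1E] := Hur_orbit (lo_ord i) gh.
  have [r2 r2E] := Hur_orbit (hi_ord i) gh.
  rewrite (hx _ _ r1E) (hx _ _ r2E).
  by apply: (hurwitz_gen_conj _ _ _ _ _ gh r1E r2E); rewrite r1E r2E.
Qed.

End HurwitzGroup.

(** * Braid relations expressed by iterated Hurwitz moves *)

Section BraidRelation.
Context {G : groupType}.
Implicit Types a b : G.

Definition hurwitz_pair (ab : G * G) : G * G := (ab.2, ab.2^-1 * ab.1 * ab.2).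

Lemma hurwitz_pair_iter_mul m a b :
  let ab := iter m hurwitz_pair (a, b) in ab.1 * ab.2 = a * b.
Proof. by elim: m => //= m <-; rewrite /= !mulgA mulgV mul1g. Qed.

Lemma altprodSr a b m :
  altprod a b m.+1 = altprod a b m * (if odd m then b else a).
Proof.
elim: m a b => [|m IH] a b; first by rewrite /= mul1g mulg1.
rewrite -[LHS]/(a * altprod b a m.+1) IH /= mulgA.
by case: (odd m).
Qed.

(* The two conditionals are the alternating products of lengths m.+1 and m that
   end in b. *)
Lemma altprod_hurwitz_pair a b m :
  (if odd m then altprod a b m.+1 else altprod b a m.+1) =
  (if odd m then altprod b a m else altprod a b m) *
  (iter m hurwitz_pair (a, b)).2.
Proof.
elim: m => [|m IH]; first by rewrite /= mul1g mulg1.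
have ab := hurwitz_pair_iter_mul m.+1 a b.
(* The last two factors [a * b] equal the product of the pair after [m.+1] moves. The first entry of
   that pair is the second entry after [m] moves, so the induction hypothesis absorbs it. *)
transitivity ((if odd m then altprod b a m else altprod a b m) * (a * b)).
  by rewrite [odd m.+1]/= !altprodSr [odd m.+1]/=; case: (odd m); rewrite /= mulgA.
rewrite -{}ab mulgA [X in _ * X * _]/= -IH [odd m.+1]/=.
by case: (odd m).
Qed.

(** For positive length, let [u] be the alternating product one factor shorter that ends in [b]. The
    product ending in [a] is [u * a], the one ending in [b] is [u] times the first entry of the
    iterated pair; cancel [u]. *)
Lemma altprod_eq_hurwitz_pair a b m :
  altprod a b m = altprod b a m <-> (iter m hurwitz_pair (a, b)).1 = a.
Proof.
case: m => [//|m]; rewrite iterS [_.1]/=.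
have := altprod_hurwitz_pair a b m; rewrite !altprodSr.
case: (odd m) => E; split=> [ab|ab].
- by apply: (@mulgI _ (altprod b a m)); rewrite -E ab.
- by rewrite E ab.
- by apply: (@mulgI _ (altprod a b m)); rewrite -E ab.
- by rewrite E ab.
Qed.

End BraidRelation.

Lemma multiplicative_altprod {G H : groupType} (f : {multiplicative G -> H}) a b m :
  f (altprod a b m) = altprod (f a) (f b) m.
Proof. by elim: m a b => [|m IH] a b /=; rewrite ?multiplicative1 // gmulfM IH. Qed.

(** The braid is chosen before the group, so that one braid serves both for a tuple and for its
    brackets. *)
Lemma braid_hurwitz_pair {n : nat} (p q : 'I_n) m : (p < q)%N ->
  exists (b : braid_group n) (i : 'I_n.-1), forall (G : groupType) (g : 'I_n -> G),
    (hurwitz_act G b g (lo_ord i), hurwitz_act G b g (hi_ord i)) =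
    iter m hurwitz_pair (g p, g q).
Proof.
move=> pq; elim: m => [|m [b [i bi]]].
  have [b [i bi]] := braid_adjoin p q pq.
  by exists b, i => G g; have [-> ->] := bi G g.
exists (braid_gen i * b), i => G g.
by rewrite hurwitz_actM hurwitz_act_lo hurwitz_act_hi iterS -bi.
Qed.

(** The relation in [G] says that some coordinate of a braided tuple is [g p]; the same coordinate
    of the braided brackets is then the bracket of [g p]. *)
Lemma hurwitz_gen_altprod {n : nat} {G : groupType} (g : 'I_n -> G) (p q : 'I_n) m :
  altprod (g p) (g q) m = altprod (g q) (g p) m ->
  let x k := hurwitz_gen (Hur_coord g k) in
  altprod (x p) (x q) m = altprod (x q) (x p) m.
Proof.
move=> + x; wlog pq : p q / (p < q)%N => [IH|].
  have [/IH//|/IH E /esym/E/esym//|/val_inj -> //] := ltngtP p q.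
move=> /altprod_eq_hurwitz_pair gm; apply/altprod_eq_hurwitz_pair.
have [b [i bi]] := braid_hurwitz_pair p q m pq.
rewrite -(bi _ x); apply: hurwitz_act_hurwitz_gen.
by rewrite -[val _]/(g p) -gm -bi.
Qed.

(** * Comparison of the Artin, dual Artin and Coxeter groups *)

Section DualArtin.
Context {n : nat} (Gamma : coxeter_graph n).

Fact artin_to_dual_subproof u v : artin_rel Gamma u v ->
  free_lift (dual_gen Gamma) u = free_lift (dual_gen Gamma) v.
Proof.
move=> uv; have := pres_gen_rel (Coxeter_braid uv).
case: uv => i j m _ _; rewrite !multiplicative_altprod /= !free_lift_gen.
exact: hurwitz_gen_altprod.
Qed.

Definition artin_to_dual : {multiplicative artin_group Gamma -> dual_artin_group Gamma} :=
  pres_lift artin_to_dual_subproof.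

Lemma artin_to_dual_gen i : artin_to_dual (artin_gen Gamma i) = dual_gen Gamma i.
Proof. exact: pres_lift_gen. Qed.

Lemma Hur_artin : Hur (artin_gen Gamma) = pi_A Gamma @` Hur (@free_gen 'I_n).
Proof.
rewrite -(Hur_morph (pi_A Gamma)); congr Hur.
by apply/funext => i; rewrite /= /pi_A free_lift_gen.
Qed.

Lemma hurwitz_act_artin_to_coxeter b :
  hurwitz_act _ b (coxeter_gen Gamma) =
  artin_to_coxeter Gamma \o hurwitz_act _ b (artin_gen Gamma).
Proof.
rewrite -(hurwitz_act_morph (artin_to_coxeter Gamma)); congr (hurwitz_act _ b _).
by apply/funext => i; rewrite /= artin_to_coxeter_gen.
Qed.

Lemma hurwitz_act_artin_to_dual b k (r : Hur (coxeter_gen Gamma)) :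
  val r = hurwitz_act _ b (coxeter_gen Gamma) k ->
  artin_to_dual (hurwitz_act _ b (artin_gen Gamma) k) = hurwitz_gen r.
Proof.
move=> /hurwitz_act_hurwitz_gen <-.
rewrite -[LHS]/((artin_to_dual \o hurwitz_act _ b (artin_gen Gamma)) k).
rewrite -hurwitz_act_morph; congr (hurwitz_act _ b _ k).
by apply/funext => i; rewrite /= artin_to_dual_gen.
Qed.

Lemma artin_to_dual_inj_Hur :
  injective artin_to_dual ->
  {in Hur (artin_gen Gamma) &, injective (artin_to_coxeter Gamma)}.
Proof.
move=> inj _ _ /set_mem[_ [b ->] [k ->]] /set_mem[_ [b' ->] [k' ->]] E.
have [r rE] := @Hur_orbit _ _ _ _ k (ex_intro _ b erefl :
  hurwitz_orbit (coxeter_gen Gamma) (hurwitz_act _ b (coxeter_gen Gamma))).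
apply: inj; rewrite (hurwitz_act_artin_to_dual _ _ _ rE).
symmetry; apply: hurwitz_act_artin_to_dual.
by rewrite rE !hurwitz_act_artin_to_coxeter.
Qed.

(** Two ways of reaching [r] as a coordinate give two elements of [Hur (artin_gen Gamma)] over [r],
    equal by injectivity. Hence [l r] can be computed from any of them. *)
Lemma Hur_artin_lift :
  {in Hur (artin_gen Gamma) &, injective (artin_to_coxeter Gamma)} ->
  exists l : Hur (coxeter_gen Gamma) -> artin_group Gamma,
  forall b k r, val r = hurwitz_act _ b (coxeter_gen Gamma) k ->
    l r = hurwitz_act _ b (artin_gen Gamma) k.
Proof.
move=> inj; suff /choice[l lP] : forall r : Hur (coxeter_gen Gamma), exists x, forall b k,
    val r = hurwitz_act _ b (coxeter_gen Gamma) k ->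
    x = hurwitz_act _ b (artin_gen Gamma) k.
  by exists l => b k r; apply: lP.
move=> r.
have [b [k rE]] := Hur_val _ r.
exists (hurwitz_act _ b (artin_gen Gamma) k) => b' k'.
rewrite rE !hurwitz_act_artin_to_coxeter => E.
apply: inj => //; apply/mem_set.
  by exists (hurwitz_act _ b (artin_gen Gamma)); [exists b | exists k].
by exists (hurwitz_act _ b' (artin_gen Gamma)); [exists b' | exists k'].
Qed.

Lemma artin_to_dual_bij :
  {in Hur (artin_gen Gamma) &, injective (artin_to_coxeter Gamma)} ->
  bijective artin_to_dual.
Proof.
move=> /Hur_artin_lift[l lP].
have lR u v : hurwitz_rel u v -> free_lift l u = free_lift l v.
  case=> _ i0 i1 r1 r2 r3 [b ->] i0E i1E.
  (* The index [i1] has value 1, so there are at least two coordinates and the first braid generator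
     exists. *)
  have lt0 : (0 < n.-1)%N by rewrite ltn_predRL -[1%N]i1E.
  pose i := Ordinal lt0.
  have {i0E}-> : i0 = lo_ord i by apply: val_inj.
  have {i1E}-> : i1 = hi_ord i by apply: val_inj.
  move=> r1E r2E r3E; rewrite !gmulfM multiplicativeV /= !free_lift_gen.
  (* The conjugate is a coordinate of the tuple after one more move, and [r3] is the same coordinate
     in the Coxeter group. *)
  rewrite (lP _ _ _ r1E) (lP _ _ _ r2E) -hurwitz_act_hi -hurwitz_actM; symmetry.
  by apply: lP; rewrite hurwitz_actM hurwitz_act_hi r3E r1E r2E.
pose f : {multiplicative dual_artin_group Gamma -> artin_group Gamma} := pres_lift lR.
have f_gen r : f (hurwitz_gen r) = l r by exact: pres_lift_gen.
exists f.
- apply: (presented_ext (f \o artin_to_dual) idfun) => i /=.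
  by rewrite artin_to_dual_gen f_gen (lP 1 i) hurwitz_act1.
- apply: (presented_ext (artin_to_dual \o f) idfun) => r /=.
  have [b [k rE]] := Hur_val _ r.
  by rewrite f_gen (lP _ _ _ rE); apply: hurwitz_act_artin_to_dual.
Qed.

End DualArtin.

Theorem theoremB (n : nat) (Gamma : coxeter_graph n) :
  Hur (artin_gen Gamma) = pi_A Gamma @` Hur (@free_gen 'I_n) /\
  (canonically_isomorphic_to_dual Gamma <->
   {in Hur (artin_gen Gamma) &, injective (artin_to_coxeter Gamma)}).
Proof.
split; first exact: Hur_artin.
split=> [[f [f_gen /bij_inj f_inj]]|inj].
  apply: artin_to_dual_inj_Hur.
  (* Agreeing with [artin_to_dual] on the generators, [f] is equal to it everywhere. *)
  apply: eq_inj f_inj _; apply: presented_ext => i.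
  by rewrite artin_to_dual_gen; apply: f_gen.
exists (artin_to_dual Gamma); split; first exact: artin_to_dual_gen.
exact: artin_to_dual_bij.
Qed.
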